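(* Consider DSGT with constant stepsize $\alpha>0$, under the assumptions (A1)--(A4) described in the context. Let $\Gamma>1$ and suppose $$\alpha\le \min\left\{\frac{1-\rho_w^2}{12\rho_w L},\ \frac{(1-\rho_w^2)^2}{2\sqrt{\Gamma}L\max\{6\rho_w\|\mathbf{W}-\mathbf{I}\|,1-\rho_w^2\}},\ \frac{1-\rho_w^2}{3\rho_w^{2/3}L}\left[\frac{\mu^2}{L^2}\frac{(\Gamma-1)}{\Gamma(\Gamma+1)}\right]^{1/3}\right\}$$ and in addition $$\alpha\le\frac{\Gamma+1}{\Gamma}\,\frac{1-\rho_w^2}{8\mu}.$$ Let $\beta=\frac{1-\rho_w^2}{2\rho_w^2}-4\alpha L-2\alpha^2L^2$ and $$\mathbf{A}=\begin{bmatrix}1-\alpha\mu & \frac{\alpha L^2}{\mu n}(1+\alpha\mu) & 0\\ 0 & \frac12(1+\rho_w^2) & \alpha^2\frac{(1+\rho_w^2)\rho_w^2}{1-\rho_w^2}\\ 2\alpha nL^3 & \left(\frac1\beta+2\right)\|\mathbf{W}-\mathbf{I}\|^2L^2+3\alpha L^3 & \frac12(1+\rho_w^2)\end{bmatrix}.$$ Then the spectral radius of $\mathbf{A}$ satisfies $$\rho(\mathbf{A})\le1-\left(\frac{\Gamma-1}{\Gamma+1}\right)\alpha\mu.$$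
   Context: Setting (DSGT). There are $n$ agents $\mathcal{N}=\{1,\dots,n\}$, with local cost functions $f_i:\mathbb{R}^p\to\mathbb{R}$, and $f=\frac1n\sum_{i=1}^nf_i$. Assumptions: (A1) Stochastic gradients: $g_i(x,\xi)$ is a (measurable) function of $x\in\mathbb{R}^p$, $\xi\in\mathbb{R}^m$; the random vectors $\xi_{i,k}$ ($i\in\mathcal{N}$, $k\ge0$) are independent across agents and iterations, and for some $\sigma>0$, for all $i,k$ and all $x\in\mathbb{R}^p$, $\mathbb{E}[g_i(x,\xi_{i,k})]=\nabla f_i(x)$ and $\mathbb{E}[\|g_i(x,\xi_{i,k})-\nabla f_i(x)\|^2]\le\sigma^2$. (A2) Each $f_i$ is $\mu$-strongly convex with $L$-Lipschitz gradient ($\mu,L>0$): $\langle\nabla f_i(x)-\nabla f_i(x'),x-x'\rangle\ge\mu\|x-x'\|^2$ and $\|\nabla f_i(x)-\nabla f_i(x')\|\le L\|x-x'\|$ for all $x,x'$. (A3) The communication graph $\mathcal{G}$ on $\mathcal{N}$ is undirected and connected. (A4) $\mathbf{W}=[w_{ij}]\in\mathbb{R}^{n\times n}$ is nonnegative and doubly stochastic ($\mathbf{W}\mathbf{1}=\mathbf{1}$, $\mathbf{1}^\top\mathbf{W}=\mathbf{1}^\top$), with $w_{ii}>0$ for some $i$; for $i\ne j$, agents $i,j$ are adjacent in $\mathcal{G}$ iff $w_{ij},w_{ji}>0$ (and $w_{ij}=w_{ji}=0$ otherwise). Algorithm: $x_{i,0}\in\mathbb{R}^p$ arbitrary (deterministic),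 $y_{i,0}=g_i(x_{i,0},\xi_{i,0})$, and for $k\ge0$ $$x_{i,k+1}=\sum_{j=1}^nw_{ij}(x_{j,k}-\alpha y_{j,k}),\qquad y_{i,k+1}=\sum_{j=1}^nw_{ij}y_{j,k}+g_i(x_{i,k+1},\xi_{i,k+1})-g_i(x_{i,k},\xi_{i,k}).$$ (The conclusion concerns only the matrix $\mathbf{A}$, which governs the convergence rate of this algorithm.) Notation: $\mathbf{1}$ is the all-ones column vector, $\mathbf{I}$ the identity. $\|\cdot\|$ is the 2-norm for vectors and the Frobenius norm for matrices. $\rho_w$ is the spectral norm of $\mathbf{W}-\frac1n\mathbf{1}\mathbf{1}^\top$ (under (A3), (A4) one has $\rho_w<1$); $\rho(\cdot)$ is the spectral radius. If $\rho_w=0$, quantities with a power of $\rho_w$ in the denominator in the stepsize bound are read as $+\infty$ and $1/\beta$ is read as $0$. *)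

(* Defs.v *)
From HB Require Import structures.
From mathcomp Require Import all_boot all_order all_algebra.
From mathcomp Require Import all_classical all_reals all_analysis.
From mathcomp Require Import finmap complex.

Set Implicit Arguments.
Unset Strict Implicit.
Unset Printing Implicit Defensive.

Import Order.TTheory GRing.Theory Num.Theory.
Import numFieldNormedType.Exports.

Local Open Scope classical_set_scope.
Local Open Scope ring_scope.

(* The norm that the library puts on 'M[R]_(m, n) is the sup norm; l2norm is
   the Euclidean norm on vectors and the Frobenius norm on matrices. *)
Definition l2norm (R : realType) (m n : nat) (M : 'M[R]_(m, n)) : R :=
  Num.sqrt (\sum_(i < m) \sum_(j < n) M i j ^+ 2).

Definition dotv (R : realType) (p : nat) (u v : 'rV[R]_p) : R :=
  \sum_(j < p) u 0 j * v 0 j.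

Definition spectral_norm (R : realType) (m n : nat) (M : 'M[R]_(m, n)) : R :=
  sup [set l2norm (M *m v) | v in [set v : 'cV[R]_n | l2norm v <= 1]].

Definition spectral_radius (R : realType) (n : nat) (M : 'M[R]_n) : R :=
  sup [set ComplexField.Normc.normc z | z in
        [set z : R[i] | eigenvalue (map_mx (real_complex R) M) z]].

Definition gradient (R : realType) (p : nat) (f : 'rV[R]_p -> R)
    (x : 'rV[R]_p) : 'rV[R]_p :=
  \row_(j < p) 'D_(delta_mx 0 j) f x.

(* R^p with its Borel sigma-algebra. *)
Definition borelRV (R : realType) (p : nat) :=
  g_sigma_algebraType (@open 'rV[R]_p).

Definition mutually_independent (R : realType) (d d' : measure_display)
    (Om : measurableType d) (P : probability Om R) (T : measurableType d')
    (I : choiceType) (X : I -> Om -> T) : Prop :=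
  forall (J : {fset I}) (B : I -> set T), (forall i, measurable (B i)) ->
    P (\big[setI/setT]_(i <- J) (X i @^-1` B i)) =
    (\prod_(i <- J) P (X i @^-1` B i))%E.

Definition has_mean (R : realType) (d : measure_display)
    (Om : measurableType d) (P : probability Om R) (p : nat)
    (X : Om -> 'rV[R]_p) (v : 'rV[R]_p) : Prop :=
  forall j : 'I_p,
    P.-integrable setT (fun w => (X w 0 j)%:E) /\
    ('E_P[(fun w => X w 0 j)%R] = (v 0 j)%:E)%E.

Definition stochastic_gradients (R : realType) (d : measure_display)
    (Om : measurableType d) (P : probability Om R) (n p m : nat)
    (f : 'I_n -> 'rV[R]_p -> R)
    (g : 'I_n -> 'rV[R]_p -> 'rV[R]_m -> 'rV[R]_p)
    (xi : 'I_n -> nat -> Om -> 'rV[R]_m) (sigma : R) : Prop :=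
  [/\ forall i, measurable_fun setT
        (fun z : borelRV R p * borelRV R m => g i z.1 z.2 : borelRV R p),
      forall i k, measurable_fun setT (xi i k : Om -> borelRV R m),
      mutually_independent P
        (fun ik : 'I_n * nat => xi ik.1 ik.2 : Om -> borelRV R m) &
      forall i k x,
        has_mean P (fun w => g i x (xi i k w)) (gradient (f i) x) /\
        ('E_P[(fun w => l2norm (g i x (xi i k w) - gradient (f i) x) ^+ 2)%R]
           <= (sigma ^+ 2)%:E)%E].

Definition strongly_convex_smooth (R : realType) (p : nat)
    (f : 'rV[R]_p -> R) (mu L : R) : Prop :=
  [/\ forall x, differentiable f x,
      forall x x', mu * l2norm (x - x') ^+ 2
        <= dotv (gradient f x - gradient f x') (x - x') &
      forall x x', l2norm (gradient f x - gradient f x') <= L * l2norm (x - x')].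

Definition undirected_connected (n : nat) (adj : rel 'I_n) : Prop :=
  symmetric adj /\ forall i j, connect adj i j.

Definition mixing_matrix (R : realType) (n : nat) (adj : rel 'I_n)
    (W : 'M[R]_n) : Prop :=
  [/\ forall i j, 0 <= W i j,
      W *m const_mx 1 = const_mx 1 :> 'cV[R]_n,
      const_mx 1 *m W = const_mx 1 :> 'rV[R]_n,
      exists i, 0 < W i i &
      forall i j, i != j ->
        if adj i j then 0 < W i j /\ 0 < W j i else W i j = 0 /\ W j i = 0].

(* x k i and y k i are the random vectors x_{i,k} and y_{i,k}. *)
Definition DSGT (R : realType) (d : measure_display) (Om : measurableType d)
    (n p m : nat) (g : 'I_n -> 'rV[R]_p -> 'rV[R]_m -> 'rV[R]_p)
    (xi : 'I_n -> nat -> Om -> 'rV[R]_m) (W : 'M[R]_n) (alpha : R)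
    (x0 : 'I_n -> 'rV[R]_p) (x y : nat -> 'I_n -> Om -> 'rV[R]_p) : Prop :=
  [/\ forall i w, x 0%N i w = x0 i,
      forall i w, y 0%N i w = g i (x 0%N i w) (xi i 0%N w),
      forall k i w, x k.+1 i w =
        \sum_(j < n) W i j *: (x k j w - alpha *: y k j w) &
      forall k i w, y k.+1 i w =
        \sum_(j < n) W i j *: y k j w
          + g i (x k.+1 i w) (xi i k.+1 w) - g i (x k i w) (xi i k w)].

Definition rho_w (R : realType) (n : nat) (W : 'M[R]_n) : R :=
  spectral_norm (W - n%:R^-1 *: (const_mx 1 : 'M[R]_n)).

(* Quotients are taken in \bar R, where the library sets 0^-1 = +oo, so the
   terms with a power of rho in the denominator are +oo when rho = 0. *)
Definition stepsize_bound (R : realType) (rho nWI mu L Gamma : R) : \bar R :=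
  Order.min
    ((1 - rho ^+ 2)%:E / (12 * rho * L)%:E)%E
    (Order.min
      (((1 - rho ^+ 2) ^+ 2)%:E
        / (2 * Num.sqrt Gamma * L
             * Num.max (6 * rho * nWI) (1 - rho ^+ 2))%:E)%E
      ((1 - rho ^+ 2)%:E / (3 * rho `^ (2 / 3) * L)%:E
        * ((mu ^+ 2 / L ^+ 2 * ((Gamma - 1) / (Gamma * (Gamma + 1))))
             `^ (1 / 3))%:E)%E).

Definition beta (R : realType) (rho alpha L : R) : R :=
  (1 - rho ^+ 2) / (2 * rho ^+ 2) - 4 * alpha * L - 2 * alpha ^+ 2 * L ^+ 2.

(* 1 / beta, with the convention beta = +oo when rho = 0. *)
Definition inv_beta (R : realType) (rho alpha L : R) : R :=
  if rho == 0 then 0 else (beta rho alpha L)^-1.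

Definition matA (R : realType) (n : nat) (rho nWI mu L alpha : R) : 'M[R]_3 :=
  \matrix_(i < 3, j < 3) nth 0 (nth [::] [::
    [:: 1 - alpha * mu;
        alpha * L ^+ 2 / (mu * n%:R) * (1 + alpha * mu);
        0];
    [:: 0;
        (1 + rho ^+ 2) / 2;
        alpha ^+ 2 * ((1 + rho ^+ 2) * rho ^+ 2 / (1 - rho ^+ 2))];
    [:: 2 * alpha * n%:R * L ^+ 3;
        (inv_beta rho alpha L + 2) * nWI ^+ 2 * L ^+ 2 + 3 * alpha * L ^+ 3;
        (1 + rho ^+ 2) / 2]] i) j.

(* Main.v *)
Require Import Defs.
From HB Require Import structures.
From mathcomp Require Import all_boot all_order all_algebra.
From mathcomp Require Import all_classical all_reals all_analysis.
From mathcomp Require Import complex ring lra.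

Set Implicit Arguments.
Unset Strict Implicit.
Unset Printing Implicit Defensive.

Import Order.TTheory GRing.Theory Num.Theory.
Import numFieldNormedType.Exports.

Local Open Scope classical_set_scope.
Local Open Scope ring_scope.

(* A nonnegative matrix A with A v <= lam v for some v > 0 has spectral radius
   at most lam.  Here lam = 1 - (Gamma-1)/(Gamma+1) alpha mu and v = (v0, 1, v2),
   where v0 and v2 turn the first and third inequalities into equalities; with
   s = lam - (1 + rho^2)/2 the second one becomes
   a23 (a31 v0 + a32) <= s^2.  Writing d = 1 - rho^2 and t = 1/Gamma, the
   stepsize bounds give a23 a31 v0 <= (1 - t) d^2 2/27, a23 a32 <= t d^2/4 and
   s >= d (3 + t)/8.  The last bound on alpha forces rho < 1, so the matrix
   entries only have to be studied for arbitrary 0 <= rho, w. *)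

(** * Spectral radius and spectral norm *)

(* [eigenvalue] is about row eigenvectors x: pairing |z| |x| <= |x| M with v
   gives |z| <= lam. *)
Lemma eigenvalue_normc_le (R : realType) (n : nat) (M : 'M[R]_n)
    (v : 'I_n -> R) (lam : R) (z : R[i]) :
    (forall i j, 0 <= M i j) -> (forall i, 0 < v i) ->
    (forall i, \sum_j M i j * v j <= lam * v i) ->
    eigenvalue (map_mx (real_complex R) M) z ->
  ComplexField.Normc.normc z <= lam.
Proof.
move=> M0 v0 Mv /eigenvalueP[x xM xN0].
pose N (c : R[i]) : R := ComplexField.Normc.normc c.
have N0 c : 0 <= N c by rewrite /N; case: c => a b; exact: sqrtr_ge0.
have Nreal (r : R) : 0 <= r -> N (real_complex R r) = r.
  by move=> r0; rewrite /N /= expr0n addr0 sqrtr_sqr ger0_norm.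
pose S := \sum_j N (x 0 j) * v j.
have S0 : 0 < S.
  have [j xj] : exists j, x 0 j != 0.
    apply/existsP; apply: contraNT xN0; rewrite negb_exists => /forallP x0.
    by apply/eqP/rowP => j; rewrite mxE; apply/eqP; have := x0 j; rewrite negbK.
  rewrite /S (bigD1 j)//= ltr_pwDl//.
    rewrite mulr_gt0// lt_neqAle N0 andbT eq_sym.
    by apply: contra xj => /eqP/ComplexField.Normc.eq0_normc ->.
  by apply: sumr_ge0 => k _; rewrite mulr_ge0// ltW.
rewrite -(ler_pM2r S0).
have row_le j : N z * N (x 0 j) <= \sum_i N (x 0 i) * M i j.
  have := congr1 (fun y : 'rV_n => N (y 0 j)) xM.
  rewrite !mxE /N ComplexField.Normc.normcM => <-.
  elim/big_ind2 : _ => [|a b c e|i _].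
  - by rewrite ComplexField.Normc.normc0.
  - by move=> ab ce; apply: le_trans (le_normcD _ _) _; rewrite lerD.
  - by rewrite mxE ComplexField.Normc.normcM -!/(N _) Nreal.
have -> : lam * S = \sum_i N (x 0 i) * (lam * v i).
  by rewrite /S mulr_sumr; apply: eq_bigr => i _; ring.
apply: (@le_trans _ _ (\sum_j (\sum_i N (x 0 i) * M i j) * v j)).
  rewrite /S mulr_sumr; apply: ler_sum => j _.
  by rewrite mulrA ler_wpM2r// ltW.
under eq_bigr do rewrite mulr_suml.
rewrite exchange_big /=; apply: ler_sum => i _.
under eq_bigr do rewrite -mulrA.
by rewrite -mulr_sumr ler_wpM2l.
Qed.

Lemma spectral_radius_le (R : realType) (n : nat) (M : 'M[R]_n)
    (v : 'I_n -> R) (lam : R) :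
    (forall i j, 0 <= M i j) -> (forall i, 0 < v i) ->
    (forall i, \sum_j M i j * v j <= lam * v i) -> 0 <= lam ->
  spectral_radius M <= lam.
Proof.
move=> M0 v0 Mv lam0; rewrite /spectral_radius.
set E := (X in sup X).
(* An empty spectrum has [sup set0 = 0]; this case is where [0 <= lam] enters. *)
have [->|/set0P E0] := eqVneq E set0; first by rewrite sup0.
apply: ge_sup => // _ [z /= Mz <-]; exact: eigenvalue_normc_le Mz.
Qed.

Lemma spectral_norm_ge0 (R : realType) (m n : nat) (M : 'M[R]_(m, n)) :
  0 <= spectral_norm M.
Proof.
rewrite /spectral_norm; set E := (X in sup X).
(* If the set has no supremum, [sup] takes its default value 0; otherwise any element, being a norm,
   bounds [sup] from below by 0. *)
have [[[r Er] ubE]|/sup_out ->//] := pselect (has_sup E).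
apply: le_trans (ub_le_sup ubE Er).
by case: Er => v _ <-; exact: sqrtr_ge0.
Qed.

(** * From the stepsize conditions to polynomial inequalities *)

Lemma le_EFin_div (R : realType) (a b c : R) : 0 < c ->
  (a%:E <= b%:E / c%:E)%E = (a * c <= b).
Proof. by move=> c0; rewrite inver gt_eqF// -EFinM lee_fin ler_pdivlMr. Qed.

(** Since [0 < rho], all denominators are positive and the extended quotients are ordinary ones. The
    second and third conclusions come from the middle term of the minimum, by bounding the maximum
    below by each of its arguments and squaring; the fourth is the cube of the last term. *)
Lemma stepsize_bound_le (R : realType) (rho w mu L Gamma alpha : R) :
    0 < rho -> rho ^+ 2 < 1 -> 0 <= w -> 0 < mu -> 0 < L -> 1 < Gamma ->
    0 < alpha ->
    (alpha%:E <= stepsize_bound rho w mu L Gamma)%E ->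
  [/\ alpha * (12 * rho * L) <= 1 - rho ^+ 2,
      4 * Gamma * (alpha * L) ^+ 2 <= (1 - rho ^+ 2) ^+ 2,
      144 * Gamma * (alpha * L * rho * w) ^+ 2 <= (1 - rho ^+ 2) ^+ 4 &
      27 * alpha ^+ 3 * L ^+ 5 * rho ^+ 2 * Gamma * (Gamma + 1)
        <= (1 - rho ^+ 2) ^+ 3 * mu ^+ 2 * (Gamma - 1)].
Proof.
move=> r0 r1 w0 mu0 L0 G1 a0.
set d := 1 - rho ^+ 2.
have d0 : 0 < d by rewrite subr_gt0.
have G0 : 0 < Gamma by apply: lt_trans G1.
have sG0 : 0 < Num.sqrt Gamma by rewrite sqrtr_gt0.
have sG2 : Num.sqrt Gamma ^+ 2 = Gamma by rewrite sqr_sqrtr// ltW.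
rewrite /stepsize_bound !le_min => /and3P[].
rewrite le_EFin_div; last by rewrite !mulr_gt0.
move=> b1.
rewrite le_EFin_div -/d; last by rewrite !mulr_gt0// lt_max d0 orbT.
move=> b2.
(* Used with [u = d] and with [u = 6 * rho * w], the two arguments of the maximum. *)
have aux u : 0 <= u -> u <= Num.max (6 * rho * w) d ->
    2 * Num.sqrt Gamma * (alpha * L) * u <= d ^+ 2.
  move=> u0 ul; apply: le_trans b2.
  have -> : alpha * (2 * Num.sqrt Gamma * L * Num.max (6 * rho * w) d) =
    2 * Num.sqrt Gamma * (alpha * L) * Num.max (6 * rho * w) d by ring.
  by rewrite ler_wpM2l// !mulr_ge0// ltW.
have b2d : 2 * Num.sqrt Gamma * (alpha * L) <= d.
  rewrite -(ler_pM2r d0) -expr2; apply: aux; first exact: ltW.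
  by rewrite le_max lexx orbT.
have b2w : 2 * Num.sqrt Gamma * (alpha * L) * (6 * rho * w) <= d ^+ 2.
  apply: aux; first by rewrite !mulr_ge0// ltW.
  by rewrite le_max lexx.
have p0 : 0 < rho `^ (2 / 3) by rewrite powR_gt0.
rewrite inver gt_eqF; last by rewrite !mulr_gt0.
set c := mu ^+ 2 / _ * _.
have c0 : 0 <= c.
  rewrite /c mulr_ge0// ?divr_ge0 ?sqr_ge0 ?mulr_ge0 ?subr_ge0 ?addr_ge0 ?ltW//.
rewrite -!EFinM lee_fin mulrAC ler_pdivlMr; last by rewrite !mulr_gt0.
move=> b3; split => //.
- have -> : 4 * Gamma * (alpha * L) ^+ 2 = (2 * Num.sqrt Gamma * (alpha * L)) ^+ 2.
    by rewrite -{1}sG2; ring.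
  by rewrite ler_sqr// nnegrE ?ltW// !mulr_gt0.
- have -> : 144 * Gamma * (alpha * L * rho * w) ^+ 2 =
      (2 * Num.sqrt Gamma * (alpha * L) * (6 * rho * w)) ^+ 2.
    by rewrite -{1}sG2; ring.
  have -> : d ^+ 4 = (d ^+ 2) ^+ 2 by ring.
  by rewrite ler_sqr// nnegrE ?sqr_ge0// !mulr_ge0// ltW.
(* Cubing turns the power 2/3 of [rho] into [rho ^+ 2] and the cube root of [c] into [c];
   multiplying by [K0]'s quantity then clears the denominator of [c]. *)
- have := b3; rewrite -(@ler_pXn2r _ 3)// ?nnegrE; first last.
  + by rewrite mulr_ge0// ?powR_ge0// ltW.
  + by rewrite !mulr_ge0// ltW.
  have cube (t e : R) : 0 <= t -> (t `^ (e / 3)) ^+ 3 = t `^ e.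
    by move=> t0; rewrite -powR_mulrn ?powR_ge0// -powRrM divfK.
  rewrite !exprMn !cube ?(ltW r0)// powRr1// powR_mulrn ?(ltW r0)// => b3'.
  have K0 : 0 < L ^+ 2 * (Gamma * (Gamma + 1)).
    by rewrite !mulr_gt0 ?exprn_gt0 ?addr_gt0.
  move: b3'; rewrite -(ler_pM2r K0).
  congr (_ <= _); first by ring.
  rewrite /c; field; rewrite ?gt_eqF ?addr_gt0//.
Qed.

(** * Bounds on the products of entries along the cycles of the matrix *)

(** With d = 1 - rho^2, the first stepsize bound reads alpha L rho <= d/12. Hence the two negative
    terms of 8 rho^2 beta remove at most (8/3 + 1/9) d from 4 d, which leaves at least d. *)
Lemma inv_beta_le (R : realType) (rho alpha L : R) :
    0 < rho -> rho ^+ 2 < 1 -> 0 <= alpha -> 0 < L ->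
    alpha * (12 * rho * L) <= 1 - rho ^+ 2 ->
  0 <= inv_beta rho alpha L <= 8 * rho ^+ 2 / (1 - rho ^+ 2).
Proof.
move=> r0 r1 a0 L0 b1; rewrite /inv_beta gt_eqF//.
have d0 : 0 < 1 - rho ^+ 2 by rewrite subr_gt0.
have r2 : 0 < rho ^+ 2 by rewrite exprn_gt0.
have rle1 : rho <= 1 by nra.
have v0 : 0 <= alpha * L * rho by rewrite !mulr_ge0// ltW.
have betaE : beta rho alpha L * (8 * rho ^+ 2) =
    4 * (1 - rho ^+ 2) - 32 * (alpha * L * rho) * rho
      - 16 * (alpha * L * rho) ^+ 2.
  by rewrite /beta; field; rewrite gt_eqF.
have le_beta : 1 - rho ^+ 2 <= beta rho alpha L * (8 * rho ^+ 2).
  by rewrite betaE; nra.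
have beta0 : 0 < beta rho alpha L.
  have c0 : 0 < 8 * rho ^+ 2 by rewrite mulr_gt0.
  by rewrite -(pmulr_lgt0 _ c0) (lt_le_trans d0).
rewrite invr_ge0 (ltW beta0)/= -[leLHS]mul1r ler_pdivrMr//.
by rewrite mulrAC ler_pdivlMr// mul1r mulrC.
Qed.

(* The left-hand side is a23 * a32, the product of the entries of [matA]. *)
Lemma consensus_tracking_le (R : realType) (rho w L Gamma alpha : R) :
    0 < rho -> rho ^+ 2 < 1 -> 0 <= w -> 0 < L -> 1 < Gamma -> 0 < alpha ->
    alpha * (12 * rho * L) <= 1 - rho ^+ 2 ->
    4 * Gamma * (alpha * L) ^+ 2 <= (1 - rho ^+ 2) ^+ 2 ->
    144 * Gamma * (alpha * L * rho * w) ^+ 2 <= (1 - rho ^+ 2) ^+ 4 ->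
  alpha ^+ 2 * ((1 + rho ^+ 2) * rho ^+ 2 / (1 - rho ^+ 2))
    * ((inv_beta rho alpha L + 2) * w ^+ 2 * L ^+ 2 + 3 * alpha * L ^+ 3)
  <= Gamma^-1 * ((1 - rho ^+ 2) ^+ 2 / 4).
Proof.
move=> r0 r1 w0 L0 G1 a0 b1 b2 b3.
have /andP[ib0 ib] := inv_beta_le r0 r1 (ltW a0) L0 b1.
set d := 1 - rho ^+ 2 in b1 b2 b3 ib *.
have d0 : 0 < d by rewrite subr_gt0.
have G0 : 0 < Gamma by apply: lt_trans G1.
have r2 : 0 < rho ^+ 2 by rewrite exprn_gt0.
set ib' := inv_beta _ _ _ in ib ib0 *.
have rle1 : rho <= 1 by nra.
pose q := (alpha * L * rho * w) ^+ 2.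
pose u := alpha * L.
have u0 : 0 < u by rewrite mulr_gt0.
have q0 : 0 <= q by rewrite sqr_ge0.
(* 8 rho^2 + 2 d = 2 + 6 rho^2 <= 8. *)
have ib8 : (ib' + 2) * d <= 8.
  have : ib' * d <= 8 * rho ^+ 2 by rewrite -ler_pdivlMr.
  by rewrite /d; lra.
(* The constant 1/9 is 16/144, with 144 from the bound on [q]. *)
have T1 : Gamma * ((1 + rho ^+ 2) * (ib' + 2) * d * q) <= d ^+ 4 / 9.
  have h : (1 + rho ^+ 2) * ((ib' + 2) * d) <= 16.
    have ib20 : 0 <= (ib' + 2) * d by rewrite mulr_ge0 ?(ltW d0)// addr_ge0.
    by rewrite (_ : 16 = 2 * 8); last ring; apply: ler_pM => //; lra.
  have Gq0 : 0 <= Gamma * q by rewrite mulr_ge0// ltW.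
  have := ler_wpM2r Gq0 h; rewrite -/q in b3; lra.
(* The constant 1/8 is 3 * 1/4 * 1/6: one factor d^2/4 bounds Gamma u^2, the other, d/6, bounds the
   rest through u rho <= d/12. *)
have T2 : Gamma * (3 * u ^+ 3 * (1 + rho ^+ 2) * rho ^+ 2) <= d ^+ 3 / 8.
  have h : u * rho * (1 + rho ^+ 2) * rho <= d / 6.
    have ur : u * rho <= d / 12 by rewrite /u; lra.
    have h0 : 0 <= u * rho by rewrite mulr_ge0// ltW.
    have h1 : (1 + rho ^+ 2) * rho <= 2 by nra.
    rewrite -mulrA (_ : d / 6 = d / 12 * 2); last by field.
    by apply: ler_pM => //; have := sqr_ge0 rho; nra.
  have Gu : Gamma * u ^+ 2 <= d ^+ 2 / 4 by rewrite /u; lra.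
  have -> : Gamma * (3 * u ^+ 3 * (1 + rho ^+ 2) * rho ^+ 2) =
      3 * ((Gamma * u ^+ 2) * (u * rho * (1 + rho ^+ 2) * rho)) by ring.
  have -> : d ^+ 3 / 8 = 3 * ((d ^+ 2 / 4) * (d / 6)) by field.
  rewrite ler_wpM2l//; apply: ler_pM => //.
    by rewrite mulr_ge0 ?sqr_ge0 ?ltW.
  by rewrite !mulr_ge0 ?addr_ge0 ?sqr_ge0 ?ltW.
(* Scaled by Gamma d^2, the claim follows from [T1] plus d times [T2], because 1/9 + 1/8 = 17/72 <
   1/4. *)
rewrite -(ler_pM2l (_ : 0 < Gamma * d ^+ 2)); last by rewrite mulr_gt0 ?exprn_gt0.
have -> : Gamma * d ^+ 2 * (Gamma^-1 * (d ^+ 2 / 4)) = d ^+ 4 / 4.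
  by field; rewrite gt_eqF.
have -> : Gamma * d ^+ 2 * (alpha ^+ 2 * ((1 + rho ^+ 2) * rho ^+ 2 / d) *
    ((ib' + 2) * w ^+ 2 * L ^+ 2 + 3 * alpha * L ^+ 3)) =
    Gamma * ((1 + rho ^+ 2) * (ib' + 2) * d * q)
    + d * (Gamma * (3 * u ^+ 3 * (1 + rho ^+ 2) * rho ^+ 2)).
  by rewrite /q /u; field; rewrite gt_eqF.
have := ler_wpM2l (ltW d0) T2.
have : 0 < d ^+ 4 by rewrite exprn_gt0.
lra.
Qed.

(* The left-hand side is a23 * (a31 * v0), where the quotient is v0. *)
Lemma coupling_le (R : realType) (rho mu L Gamma alpha N : R) :
    0 < N ->
    rho ^+ 2 < 1 -> 0 < L -> 0 < mu -> 1 < Gamma -> 0 < alpha ->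
    alpha * mu <= (1 - rho ^+ 2) / 4 ->
    27 * alpha ^+ 3 * L ^+ 5 * rho ^+ 2 * Gamma * (Gamma + 1)
      <= (1 - rho ^+ 2) ^+ 3 * mu ^+ 2 * (Gamma - 1) ->
  alpha ^+ 2 * ((1 + rho ^+ 2) * rho ^+ 2 / (1 - rho ^+ 2))
    * (2 * alpha * N * L ^+ 3
        * (alpha * L ^+ 2 / (mu * N) * (1 + alpha * mu)
             / (2 / (Gamma + 1) * (alpha * mu))))
  <= (1 - Gamma^-1) * ((1 - rho ^+ 2) ^+ 2 * (2 / 27)).
Proof.
move=> N0 r1 L0 mu0 G1 a0 amu b4.
set d := 1 - rho ^+ 2 in amu b4 *.
have d0 : 0 < d by rewrite subr_gt0.
have G0 : 0 < Gamma by apply: lt_trans G1.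
have G10 : 0 < Gamma + 1 by rewrite addr_gt0.
set X := (X in X <= _) in b4.
have X0 : 0 <= X.
  have [aa ll] := (exprn_gt0 3 a0, exprn_gt0 5 L0).
  rewrite /X !(pmulr_lge0 _ G10, pmulr_lge0 _ G0) mulr_ge0 ?sqr_ge0//.
  by rewrite (pmulr_lge0 _ ll) (pmulr_lge0 _ aa).
(* The product is at most (2 - d)(1 + d/4) = 2 - d/2 - d^2/4. *)
have h : (1 + rho ^+ 2) * (1 + alpha * mu) <= 2.
  have am0 : 0 < alpha * mu by rewrite mulr_gt0.
  have : rho ^+ 2 = 1 - d by rewrite /d; ring.
  have := sqr_ge0 rho; nra.
(* This factor makes the left side exactly [X] times the product bounded in [h]; [N] cancels. The 2
   of [h] and the 27 of [X] give the constant 2/27. *)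
rewrite -(ler_pM2l (_ : 0 < 27 * Gamma * d * mu ^+ 2)); last first.
  by rewrite !mulr_gt0 ?exprn_gt0.
have -> : 27 * Gamma * d * mu ^+ 2 * ((1 - Gamma^-1) * (d ^+ 2 * (2 / 27))) =
   d ^+ 3 * mu ^+ 2 * (Gamma - 1) * 2.
  by field; rewrite gt_eqF.
rewrite [leLHS](_ : _ = X * ((1 + rho ^+ 2) * (1 + alpha * mu))).
  apply: ler_pM => //.
  by rewrite mulr_ge0 ?addr_ge0 ?sqr_ge0 ?mulr_ge0 ?ltW.
by rewrite /X; field; rewrite ?gt_eqF.
Qed.

(** After division by d^2 it suffices to compare a linear function of t with (3 + t)^2/64. Both
    equal 1/4 at t = 1, where the linear one has slope 19/108 and the square only 1/8; by convexity
    the square stays above for t <= 1. *)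
Lemma margin_sqr_ge (R : realFieldType) (d t s : R) :
    0 < d -> 0 <= t <= 1 -> d * (3 + t) / 8 <= s ->
  (1 - t) * (d ^+ 2 * (2 / 27)) + t * (d ^+ 2 / 4) <= s ^+ 2.
Proof.
move=> d0 /andP[t0 t1] ds.
apply: (@le_trans _ _ ((d * (3 + t) / 8) ^+ 2)); last first.
  rewrite ler_sqr// nnegrE; last by apply: le_trans ds; nra.
  by nra.
have d2 : 0 < d ^+ 2 by rewrite exprn_gt0.
have -> : (d * (3 + t) / 8) ^+ 2 = d ^+ 2 * ((3 + t) ^+ 2 / 64) by field.
have -> : (1 - t) * (d ^+ 2 * (2 / 27)) + t * (d ^+ 2 / 4) =
  d ^+ 2 * ((1 - t) * (2 / 27) + t / 4) by field.
by rewrite ler_pM2l//; nra.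
Qed.

(** * The positive test vector for [matA] *)

Lemma spectral_radius_matA_le (R : realType) (n : nat)
    (rho w mu L Gamma alpha : R) :
    (0 < n)%N -> 0 <= rho -> 0 <= w -> 0 < mu -> 0 < L -> 1 < Gamma ->
    0 < alpha ->
    (alpha%:E <= stepsize_bound rho w mu L Gamma)%E ->
    alpha <= (Gamma + 1) / Gamma * ((1 - rho ^+ 2) / (8 * mu)) ->
  spectral_radius (matA n rho w mu L alpha)
    <= 1 - (Gamma - 1) / (Gamma + 1) * alpha * mu.
Proof.
move=> n0 rho0 w0 mu0 L0 G1 a0 b b'.
have N0 : 0 < n%:R :> R by rewrite ltr0n.
have G0 : 0 < Gamma by apply: lt_trans G1.
have G10 : 0 < Gamma + 1 by rewrite addr_gt0.
have am0 : 0 < alpha * mu by rewrite mulr_gt0.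
pose t := Gamma^-1.
have t01 : 0 < t < 1 by rewrite invr_gt0 G0 invf_lt1.
have {b'}am_le : alpha * mu <= (1 + t) * (1 - rho ^+ 2) / 8.
  have := ler_wpM2r (ltW mu0) b'.
  by congr (_ <= _); rewrite /t; field; rewrite ?gt_eqF.
have d0 : 0 < 1 - rho ^+ 2.
  by rewrite -(@pmulr_rgt0 _ (1 + t)); nra.
have am4 : alpha * mu <= (1 - rho ^+ 2) / 4 by nra.
set lam := 1 - _.
(* The gap between [lam] and the first diagonal entry is the denominator of [v0]. *)
have lamE : lam - (1 - alpha * mu) = 2 / (Gamma + 1) * (alpha * mu).
  by rewrite /lam; field; rewrite gt_eqF.
pose s := lam - (1 + rho ^+ 2) / 2.
(* Since (Gamma - 1)/(Gamma + 1) * (1 + t) = 1 - t, the bound on alpha mu gives s >= d/2 - (1 - t)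
   d/8, with d = 1 - rho^2. *)
have s_ge : (1 - rho ^+ 2) * (3 + t) / 8 <= s.
  have : (Gamma - 1) / (Gamma + 1) * (alpha * mu) <=
      (Gamma - 1) / (Gamma + 1) * ((1 + t) * (1 - rho ^+ 2) / 8).
    by rewrite ler_wpM2l// divr_ge0 ?subr_ge0 ?ltW.
  rewrite [leRHS](_ : _ = (1 - t) * (1 - rho ^+ 2) / 8); last first.
    by rewrite /t; field; rewrite ?gt_eqF.
  by rewrite /s /lam; lra.
have s0 : 0 < s by apply: lt_le_trans s_ge; nra.
have lam0 : 0 <= lam by have := sqr_ge0 rho; rewrite /s in s0; lra.
pose a12 := alpha * L ^+ 2 / (mu * n%:R) * (1 + alpha * mu).
pose a23 := alpha ^+ 2 * ((1 + rho ^+ 2) * rho ^+ 2 / (1 - rho ^+ 2)).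
pose a31 := 2 * alpha * n%:R * L ^+ 3.
pose a32 := (inv_beta rho alpha L + 2) * w ^+ 2 * L ^+ 2 + 3 * alpha * L ^+ 3.
pose v0 := a12 / (2 / (Gamma + 1) * (alpha * mu)).
have key : 0 <= inv_beta rho alpha L /\ a23 * (a31 * v0 + a32) <= s ^+ 2.
  (* For [rho = 0] the entry [a23] vanishes and [inv_beta] is 0 by convention; the polynomial bounds
     serve only [rho > 0]. *)
  have [rE|rN0] := eqVneq rho 0.
    by rewrite /inv_beta /a23 rE eqxx expr0n/= mulr0 mul0r mulr0 mul0r sqr_ge0.
  have rho_gt0 : 0 < rho by rewrite lt_neqAle eq_sym rN0.
  have rho1 : rho ^+ 2 < 1 by rewrite -subr_gt0.
  have [b1 b2 b3 b4] := stepsize_bound_le rho_gt0 rho1 w0 mu0 L0 G1 a0 b.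
  split; first by have /andP[] := inv_beta_le rho_gt0 rho1 (ltW a0) L0 b1.
  (* The square of the margin is shared out with weights 1 - t for the [a31] term and t for the
     [a32] term. *)
  rewrite mulrDr; apply: le_trans (margin_sqr_ge d0 _ s_ge); last first.
    by case/andP: t01 => /ltW-> /ltW->.
  apply: lerD; first exact: coupling_le.
  exact: consensus_tracking_le.
case: key => ib0 key.
have a12_gt0 : 0 < a12.
  by rewrite /a12 mulr_gt0 ?divr_gt0 ?addr_gt0 ?mulr_gt0 ?exprn_gt0.
have a23_ge0 : 0 <= a23.
  rewrite /a23 mulr_ge0 ?sqr_ge0// divr_ge0 ?(ltW d0)//.
  by rewrite mulr_ge0 ?addr_ge0 ?sqr_ge0.
have a31_gt0 : 0 < a31 by rewrite /a31 !mulr_gt0 ?exprn_gt0.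
have a32_ge0 : 0 <= a32.
  rewrite /a32 addr_ge0 ?(pmulr_lge0 _ (exprn_gt0 _ L0))//.
    by rewrite mulr_ge0 ?sqr_ge0// addr_ge0.
  by rewrite mulr_ge0// ltW.
have v0_gt0 : 0 < v0 by rewrite /v0 divr_gt0// mulr_gt0// divr_gt0.
pose v2 := (a31 * v0 + a32) / s.
have v2_gt0 : 0 < v2 by rewrite /v2 divr_gt0// ltr_wpDr// mulr_gt0.
apply: (@spectral_radius_le _ _ _ (fun i : 'I_3 => nth 0 [:: v0; 1; v2] i)) => //.
- have am1 : 0 <= 1 - alpha * mu by have := sqr_ge0 rho; lra.
  have a22 : 0 <= (1 + rho ^+ 2) / 2 by rewrite divr_ge0 ?addr_ge0 ?sqr_ge0.
  move=> i j; rewrite mxE -/a12 -/a23 -/a31 -/a32.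
  by case: i j => -[|[|[|//]]] ? [] [|[|[|//]]] ? //=; exact: ltW.
- by case=> -[|[|[|//]]].
- move=> i; rewrite !big_ord_recl big_ord0 !mxE -/a12 -/a23 -/a31 -/a32.
  case: i => -[|[|[|//]]] ? /=.
  + have : v0 * (lam - (1 - alpha * mu)) = a12.
      by rewrite lamE /v0 divfK// gt_eqF// mulr_gt0 ?divr_gt0.
    by move=> <-; lra.
  (* This is [key] divided by [s]; it is the only row where the inequality may be strict. *)
  + have : a23 * v2 <= s by rewrite mulrA ler_pdivrMr -?expr2.
    by rewrite /s; lra.
  + have : v2 * s = a31 * v0 + a32 by rewrite divfK// gt_eqF.
    by rewrite /s; lra.
Qed.

Theorem corollary1 (R : realType) (d : measure_display)
    (Om : measurableType d) (P : probability Om R)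
    (n p m : nat) (n_gt0 : (0 < n)%N) (p_gt0 : (0 < p)%N)
    (f : 'I_n -> 'rV[R]_p -> R)
    (g : 'I_n -> 'rV[R]_p -> 'rV[R]_m -> 'rV[R]_p)
    (xi : 'I_n -> nat -> Om -> 'rV[R]_m)
    (sigma mu L : R) (sigma_gt0 : 0 < sigma) (mu_gt0 : 0 < mu) (L_gt0 : 0 < L)
    (adj : rel 'I_n) (W : 'M[R]_n) (alpha : R) (alpha_gt0 : 0 < alpha)
    (x0 : 'I_n -> 'rV[R]_p) (x y : nat -> 'I_n -> Om -> 'rV[R]_p)
    (A1 : stochastic_gradients P f g xi sigma)
    (A2 : forall i, strongly_convex_smooth (f i) mu L)
    (A3 : undirected_connected adj)
    (A4 : mixing_matrix adj W)
    (xy_dsgt : DSGT g xi W alpha x0 x y)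
    (Gamma : R) (Gamma_gt1 : 1 < Gamma)
    (alpha_le : (alpha%:E
       <= stepsize_bound (rho_w W) (l2norm (W - 1%:M)) mu L Gamma)%E)
    (alpha_le' : alpha
       <= (Gamma + 1) / Gamma * ((1 - rho_w W ^+ 2) / (8 * mu))) :
  spectral_radius (matA n (rho_w W) (l2norm (W - 1%:M)) mu L alpha)
    <= 1 - (Gamma - 1) / (Gamma + 1) * alpha * mu.
Proof.
apply: spectral_radius_matA_le => //; first exact: spectral_norm_ge0.
exact: sqrtr_ge0.
Qed.
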